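(* Let $\tilde g^i(y)=y^\top\tilde G^iy+(\tilde l^i)^\top y+\tilde c^i$, $i=1,\dots,m$, with $\tilde G^i$ symmetric $n\times n$, $\tilde l^i\in\mathbb{R}^n$, $\tilde c^i\in\mathbb{R}$; let $\tilde g=(\tilde g^1,\dots,\tilde g^m)$ and $\mathbf{Y}=\{y\in\mathbb{R}^n:\tilde g(y)=0\}$. For $\theta\in\mathbb{R}^n$ consider $$(E_\theta)\qquad\min_{y\in\mathbb{R}^n}\ \|y-\theta\|^2\quad\text{s.t.}\quad\tilde g^i(y)=0,\ i=1,\dots,m.$$ Let $\bar\theta\in\mathbf{Y}$ be such that $\mathrm{ACQ}_{\mathbf{Y}}(\bar\theta)$ holds. Let $s=\mathrm{codim}_{\bar\theta}\mathbf{Y}$, let $\tilde\sigma_s$ be the $s$-th largest singular value of the Jacobian $\nabla\tilde g(\bar\theta)$, and let $\|\tilde{\mathcal{G}}\|$ be the operator norm of the linear map $\tilde{\mathcal{G}}(\lambda)=\sum_{i=1}^m\lambda_i\tilde G^i$. Let $\theta\in\mathbb{R}^n$ be a point in the normal space of $\mathbf{Y}$ at $\bar\theta$ (i.e., $\theta-\bar\theta$ lies in the row space of $\nabla\tilde g(\bar\theta)$) such that $$\|\theta-\bar\theta\|<\frac{\tilde\sigma_s}{2\|\tilde{\mathcal{G}}\|}.$$ Then $(E_\theta)$ has zero duality gap and the SDP relaxation recovers the minimizer.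
   Context: For a quadratic polynomial $q(y)=y^\top Ay+2b^\top y+e$ ($A$ symmetric) let $M(q)=\begin{pmatrix}e&b^\top\\ b&A\end{pmatrix}\in\mathbb{S}^{n+1}$ be the matrix of its homogenization in the variables $x=(z_0,y)$, where $\mathbb{S}^{k}$ denotes real symmetric $k\times k$ matrices; write $E_{00}$ for the matrix with a single $1$ in the top left entry, and $\bullet$ for the trace inner product. The SDP relaxations of an inhomogeneous problem $\min\{\tilde f(y):\tilde g^i(y)=0,\ i=1,\dots,m\}$ are those of its homogenization (with constraint $z_0^2=1$), namely $$(P)\ \min_{S\in\mathbb{S}^{n+1}} M(\tilde f)\bullet S\ \text{ s.t. } M(\tilde g^i)\bullet S=0\ \forall i,\ E_{00}\bullet S=1,\ S\succeq0;$$ $$(D)\ \max_{\lambda_0\in\mathbb{R},\,\mu\in\mathbb{R}^m}-\lambda_0\ \text{ s.t. } M(\tilde f)+\lambda_0E_{00}+\sum_i\mu_iM(\tilde g^i)\succeq0.$$ Here $\tilde f(y)=\|y-\theta\|^2$. Zero duality gap means that the optimal value of the problem equals those of $(P)$ and $(D)$. ''The SDP recovers the minimizer'' means that $(P)$ has a unique optimal solution and it equals $xx^\top$ with $x=(1,y)$ and $y$ the minimizer of the problem. Abadie constraint qualification: for $y\in\mathbf{Y}$, $\mathrm{ACQ}_{\mathbf{Y}}(y)$ holds if $\mathbf{Y}$ is a smooth manifold near $y$ and $\mathrm{rank}\,\nabla\tilde g(y)=\mathrm{codim}_y\mathbf{Y}:=n-\dim_y\mathbf{Y}$. The operator norm of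 $\tilde{\mathcal{G}}:\mathbb{R}^m\to\mathbb{S}^n$ is taken with respect to the Euclidean norm on $\mathbb{R}^m$ and the Frobenius norm on $\mathbb{S}^n$. *)

(* Defs.v *)
From mathcomp Require Import all_boot all_order all_algebra.
From mathcomp Require Import polyrcf.
From mathcomp Require Import all_classical all_reals all_analysis.

Set Implicit Arguments.
Unset Strict Implicit.
Unset Printing Implicit Defensive.

Import Order.TTheory GRing.Theory Num.Theory.
Import numFieldNormedType.Exports.

Local Open Scope classical_set_scope.
Local Open Scope ring_scope.

(* Points of R^n are row vectors 'rV[R]_n, so y^T A y is y *m A *m y^T. *)

(* Frobenius norm; on row vectors it is the Euclidean norm.  The library's
   `|_| on matrices is the sup norm. *)
Definition frob (R : realType) (m n : nat) (A : 'M[R]_(m, n)) : R :=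
  Num.sqrt (\sum_(i < m) \sum_(j < n) A i j ^+ 2).

Definition mxdot (R : realType) (k : nat) (A B : 'M[R]_k) : R := \tr (A^T *m B).

Definition psdmx (R : realType) (k : nat) (S : 'M[R]_k) : Prop :=
  S^T = S /\ forall v : 'rV[R]_k, 0 <= (v *m S *m v^T) 0 0.

(* q(y) = y^T A y + 2 b^T y + e *)
Record quadpoly (R : realType) (n : nat) := QuadPoly {
  quadA : 'M[R]_n;
  quadb : 'rV[R]_n;
  quade : R }.

Definition qeval (R : realType) (n : nat) (q : quadpoly R n) (y : 'rV[R]_n) : R :=
  (y *m quadA q *m y^T) 0 0 + 2 * (quadb q *m y^T) 0 0 + quade q.

Definition hommx (R : realType) (n : nat) (q : quadpoly R n) : 'M[R]_(1 + n) :=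
  block_mx (quade q)%:M (quadb q) (quadb q)^T (quadA q).

Definition E00 (R : realType) (n : nat) : 'M[R]_(1 + n) := delta_mx ord0 ord0.

(* y^T G y + l^T y + c *)
Definition quadpoly_of (R : realType) (n : nat)
    (G : 'M[R]_n) (l : 'rV[R]_n) (c : R) : quadpoly R n :=
  QuadPoly G (2^-1 *: l) c.

Definition sqdist (R : realType) (n : nat) (theta : 'rV[R]_n) : quadpoly R n :=
  QuadPoly 1%:M (- theta) (frob theta ^+ 2).

Lemma qeval_quadpoly_of (R : realType) (n : nat)
    (G : 'M[R]_n) (l : 'rV[R]_n) (c : R) (y : 'rV[R]_n) :
  qeval (quadpoly_of G l c) y = (y *m G *m y^T) 0 0 + (l *m y^T) 0 0 + c.
Proof. by rewrite /qeval /= -scalemxAl [in 2 * _]mxE mulrA divff ?mul1r. Qed.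

Lemma qeval_sqdist (R : realType) (n : nat) (theta y : 'rV[R]_n) :
  qeval (sqdist theta) y = frob (y - theta) ^+ 2.
Proof.
have sq (v : 'rV[R]_n) : frob v ^+ 2 = \sum_j v 0 j ^+ 2.
  rewrite /frob big_ord1 sqr_sqrtr //.
  by apply: sumr_ge0 => j _; rewrite sqr_ge0.
rewrite /qeval /= !sq mulmx1 !mxE mulr_sumr -!big_split /=.
apply: eq_bigr => j _.
by rewrite !mxE sqrrB mulNr mulrN mulr_natl -expr2 [theta _ _ * _]mulrC.
Qed.

Definition opt_min (R : realType) (T : Type) (f : T -> R) (D : set T) : \bar R :=
  ereal_inf [set (f x)%:E | x in D].

Definition opt_max (R : realType) (T : Type) (f : T -> R) (D : set T) : \bar R :=
  ereal_sup [set (f x)%:E | x in D].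

Definition minimizers (R : realType) (T : Type) (f : T -> R) (D : set T) : set T :=
  [set x | D x /\ forall z, D z -> f x <= f z].

Section Qcqp.
Variables (R : realType) (n m : nat).
Implicit Types (f : quadpoly R n) (g : 'I_m -> quadpoly R n).

Definition variety g : set 'rV[R]_n := [set y | forall i, qeval (g i) y = 0].

Definition primal_feasible g : set 'M[R]_(1 + n) :=
  [set S | [/\ forall i, mxdot (hommx (g i)) S = 0, mxdot (E00 R n) S = 1
             & psdmx S]].

Definition primal_objective f (S : 'M[R]_(1 + n)) : R := mxdot (hommx f) S.

Definition dual_feasible f g : set (R * 'rV[R]_m) :=
  [set p : R * 'rV[R]_m |
     psdmx (hommx f + p.1 *: E00 R n + \sum_i p.2 0 i *: hommx (g i))].

Definition dual_objective (p : R * 'rV[R]_m) : R := - p.1.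

Definition zero_duality_gap f g : Prop :=
  opt_min (qeval f) (variety g) = opt_min (primal_objective f) (primal_feasible g)
  /\ opt_min (qeval f) (variety g) = opt_max dual_objective (dual_feasible f g).

Definition lift1 (y : 'rV[R]_n) : 'M[R]_(1 + n) :=
  let x : 'rV[R]_(1 + n) := row_mx 1%:M y in x^T *m x.

Definition sdp_recovers_minimizer f g : Prop :=
  exists y : 'rV[R]_n,
    minimizers (qeval f) (variety g) = [set y] /\
    minimizers (primal_objective f) (primal_feasible g) = [set lift1 y].

(* The library's jacobian acts on row vectors from the right: entry (j, i) is
   d g_i / d y_j.  The transpose has the gradients as its rows. *)
Definition nabla g (y : 'rV[R]_n) : 'M[R]_(m, n) :=
  (jacobian (fun z : 'rV[R]_n => \row_i qeval (g i) z) y)^T.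

End Qcqp.

(* C^k on an open set U, by iterating directional derivatives. *)
Fixpoint Ck_on (R : realType) (n p : nat) (k : nat) (U : set 'rV[R]_n)
    (f : 'rV[R]_n -> 'rV[R]_p) : Prop :=
  match k with
  | 0%N => forall x, U x -> {for x, continuous f}
  | k'.+1 => (forall x, U x -> differentiable f x) /\
             forall v : 'rV[R]_n, Ck_on k' U (fun x => 'D_v f x)
  end.

Definition smooth_on (R : realType) (n p : nat) (U : set 'rV[R]_n)
    (f : 'rV[R]_n -> 'rV[R]_p) : Prop := forall k, Ck_on k U f.

(* Y is, near y, an embedded C^oo submanifold of R^n of dimension d: a smooth
   diffeomorphism phi : U -> V of open sets, with inverse psi, straightens
   Y `&` U to the slice of V where the last n - d coordinates vanish. *)
Definition submanifold_near (R : realType) (n : nat) (Y : set 'rV[R]_n)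
    (y : 'rV[R]_n) (d : nat) : Prop :=
  exists (U V : set 'rV[R]_n) (phi psi : 'rV[R]_n -> 'rV[R]_n),
    [/\ open U, U y & open V] /\
    [/\ smooth_on U phi, smooth_on V psi,
        (forall x, U x -> V (phi x) /\ psi (phi x) = x) &
        (forall z, V z -> U (psi z) /\ phi (psi z) = z)] /\
    (forall x, U x ->
       (Y x <-> forall j : 'I_n, (d <= j)%N -> phi x 0 j = 0)).

Definition codim_at (R : realType) (n : nat) (Y : set 'rV[R]_n)
    (y : 'rV[R]_n) (s : nat) : Prop :=
  exists2 d : nat, (d <= n)%N & submanifold_near Y y d /\ s = (n - d)%N.

(* ACQ at y; the codimension s, which is determined by (Y, y), is an argument
   so that it can be referred to. *)
Definition ACQ (R : realType) (n m : nat) (g : 'I_m -> quadpoly R n)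
    (y : 'rV[R]_n) (s : nat) : Prop :=
  codim_at (variety g) y s /\ \rank (nabla g y) = s.

(* Square roots of the eigenvalues of A^T A, repeated according to their
   multiplicity, in nonincreasing order (rootsR p lists the distinct real roots
   of p in increasing order). *)
Definition singular_values (R : realType) (m n : nat) (A : 'M[R]_(m, n)) : seq R :=
  let p := char_poly (A^T *m A) in
  rev (flatten [seq nseq (mup x p) (Num.sqrt x) | x <- rootsR p]).

(* The s-th largest singular value, counted from s = 1; an empty minimum, +oo,
   for s = 0. *)
Definition singular_value (R : realType) (m n : nat) (A : 'M[R]_(m, n))
    (s : nat) : \bar R :=
  if s is k.+1 then (nth 0 (singular_values A) k)%:E else +oo%E.

(* Operator norm of lambda |-> \sum_i lambda_i G_i, from the Euclidean to the
   Frobenius norm. *)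
Definition opnorm (R : realType) (n m : nat) (G : 'I_m -> 'M[R]_n) : R :=
  sup [set frob (\sum_i lambda 0 i *: G i) |
         lambda in [set lambda : 'rV[R]_m | frob lambda <= 1]].

(* Main.v *)
Require Import Defs.
From mathcomp Require Import all_boot all_order all_algebra.
From mathcomp Require Import polyrcf complex sesquilinear spectral.
From mathcomp Require Import ring lra.
From mathcomp Require Import all_classical all_reals all_analysis.

Set Implicit Arguments.
Unset Strict Implicit.
Unset Printing Implicit Defensive.

Import Order.TTheory GRing.Theory Num.Theory.
Import numFieldNormedType.Exports.

Local Open Scope classical_set_scope.
Local Open Scope ring_scope.

(** The proof exhibits a Lagrange multiplier for which the Lagrangian is a
strictly convex quadratic minimized at thetabar, and reads off everything from
the matrix of that Lagrangian.

Let J be the Jacobian at thetabar. As theta - thetabar lies in the row space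
of J, there is lambda with lambda J = 2 (theta - thetabar), which says that
L(y) = |y - theta|^2 + sum_i lambda_i g_i(y) is stationary at thetabar. Choosing
lambda in the column space of J, the spectral theorem for J^T J gives
sigma_s |lambda| <= 2 |theta - thetabar|, because rank J = s leaves no
positive singular value below sigma_s ([multiplier_norm_bound]). Hence
K = sum_i lambda_i G_i satisfies |K| <= |lambda| ||G|| < 1, where |K| is the
Frobenius norm.

The quadratic part of L is 1 + K and L - |thetabar - theta|^2 vanishes to first
order at thetabar, so its homogenized matrix is M = N (1 + K) N^T, where
v |-> v N is the linear map (z0, y) |-> y - z0 thetabar
([hommx_centered]). For a positive semidefinite S this gives
  M . S = (1 + K) . N^T S N >= (1 - |K|) tr (N^T S N) >= 0
([mxdot_psd_ge]): the multiplier is dual feasible with value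
|thetabar - theta|^2, and equality forces N^T S N = 0, which with S_00 = 1
leaves only S = x x^T for x = (1, thetabar) ([centering_lift1]). Weak duality
then makes this S the unique primal solution and closes both gaps
([tight_of_certificate]). *)

(** * Frobenius product and positive semidefinite matrices *)

(** Every Cauchy-Schwarz inequality below is an instance of this; the form in
two variables is symmetric in [a] and [c], so that neither has to be nonzero. *)
Lemma discriminant_le (R : realFieldType) (a b c : R) :
  (forall x y, 0 <= x ^+ 2 * a + 2 * x * y * b + y ^+ 2 * c) -> b ^+ 2 <= a * c.
Proof.
move=> h.
have a0 : 0 <= a by have := h 1 0; lra.
have c0 : 0 <= c by have := h 0 1; lra.
have [c1|cN0] := eqVneq c 0; last first.
  have c_gt0 : 0 < c by rewrite lt_def cN0.
  have := h c (- b).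
  have -> : c ^+ 2 * a + 2 * c * - b * b + (- b) ^+ 2 * c = c * (a * c - b ^+ 2).
    by ring.
  by rewrite pmulr_rge0// subr_ge0.
have [a1|aN0] := eqVneq a 0.
  have := h 1 (- b); rewrite c1 a1; lra.
have a_gt0 : 0 < a by rewrite lt_def aN0.
have := h (- b) a.
have -> : (- b) ^+ 2 * a + 2 * - b * a * b + a ^+ 2 * c = a * (a * c - b ^+ 2).
  by ring.
by rewrite pmulr_rge0// subr_ge0.
Qed.

Section FrobeniusProduct.
Context {R : realType} {k : nat}.
Implicit Types A B C : 'M[R]_k.

Lemma mxdotE A B : mxdot A B = \sum_i \sum_j A i j * B i j.
Proof.
rewrite /mxdot /mxtrace exchange_big; apply: eq_bigr => i _.
by rewrite mxE; apply: eq_bigr => j _; rewrite mxE.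
Qed.

Lemma mxdotC A B : mxdot A B = mxdot B A.
Proof.
by rewrite !mxdotE; apply: eq_bigr => i _; apply: eq_bigr => j _; rewrite mulrC.
Qed.

Lemma mxdotDl A B C : mxdot (A + B) C = mxdot A C + mxdot B C.
Proof. by rewrite /mxdot linearD/= mulmxDl mxtraceD. Qed.

Lemma mxdotZl (a : R) A C : mxdot (a *: A) C = a * mxdot A C.
Proof. by rewrite /mxdot linearZ/= -scalemxAl mxtraceZ. Qed.

Lemma mxdot_suml (I : finType) (F : I -> 'M[R]_k) C :
  mxdot (\sum_i F i) C = \sum_i mxdot (F i) C.
Proof.
apply: (big_morph (fun A => mxdot A C)) => [A B|]; first exact: mxdotDl.
by rewrite -(scale0r (0 : 'M[R]_k)) mxdotZl mul0r.
Qed.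

Lemma mxdot_ge0 A : 0 <= mxdot A A.
Proof. by rewrite mxdotE; do 2![apply: sumr_ge0 => ? _]; rewrite -expr2 sqr_ge0. Qed.

Lemma frob_mxdot A : frob A = Num.sqrt (mxdot A A).
Proof.
congr Num.sqrt; rewrite mxdotE.
by apply: eq_bigr => i _; apply: eq_bigr => j _; rewrite expr2.
Qed.

Lemma mxdot_CauchySchwarz A B : `|mxdot A B| <= frob A * frob B.
Proof.
rewrite !frob_mxdot -sqrtrM ?mxdot_ge0// -sqrtr_sqr ler_sqrt.
  apply: discriminant_le => x y.
  rewrite (_ : _ + _ = mxdot (x *: A + y *: B) (x *: A + y *: B)) ?mxdot_ge0//.
  rewrite mxdotDl !mxdotZl ![mxdot _ (_ + _)]mxdotC !mxdotDl !mxdotZl.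
  rewrite (mxdotC B A); ring.
by rewrite mulr_ge0// mxdot_ge0.
Qed.

Lemma mxdot_trmxr A B : A^T = A -> mxdot A B = \tr (A *m B).
Proof. by rewrite /mxdot => ->. Qed.

Lemma mxdot_gram A (v : 'rV[R]_k) : mxdot A (v^T *m v) = (v *m A *m v^T) 0 0.
Proof.
by rewrite mxdotC mxdot_trmxr ?trmx_mul ?trmxK// -mulmxA mxtrace_mulC trace_mx11.
Qed.

End FrobeniusProduct.

Lemma frob_ge0 (R : realType) m n (A : 'M[R]_(m, n)) : 0 <= frob A.
Proof. exact: sqrtr_ge0. Qed.

Lemma frob_eq0 (R : realType) m n (A : 'M[R]_(m, n)) : frob A = 0 -> A = 0.
Proof.
have ge0 i : 0 <= \sum_j A i j ^+ 2 by apply: sumr_ge0 => ? _; exact: sqr_ge0.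
move=> /eqP; rewrite sqrtr_eq0 => hle.
have /eqP : \sum_i \sum_j A i j ^+ 2 = 0.
  by apply/eqP; rewrite eq_le hle sumr_ge0.
rewrite psumr_eq0// => /allP h; apply/matrixP => i j.
have := h i (mem_index_enum i); rewrite /= psumr_eq0 => [/allP|? _]; last exact: sqr_ge0.
by move=> /(_ j (mem_index_enum j)); rewrite /= sqrf_eq0 mxE => /eqP.
Qed.

Section PositiveSemidefinite.
Context {R : realType}.

Lemma psd_CauchySchwarz k (S : 'M[R]_k) (u v : 'rV[R]_k) : psdmx S ->
  (u *m S *m v^T) 0 0 ^+ 2 <= (u *m S *m u^T) 0 0 * (v *m S *m v^T) 0 0.
Proof.
move=> [symS S_ge0]; apply: discriminant_le => x y.
have symuv : (v *m S *m u^T) 0 0 = (u *m S *m v^T) 0 0.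
  rewrite -[v *m S *m u^T]trmxK [LHS]mxE.
  by rewrite !trmx_mul trmxK symS mulmxA.
have := S_ge0 (x *: u + y *: v).
rewrite linearD !linearZ/= !mulmxDl !mulmxDr -!scalemxAl -!scalemxAr.
move: symuv; move: (u *m S *m u^T) (u *m S *m v^T) (v *m S *m u^T) (v *m S *m v^T).
move=> a b b' c symuv; rewrite !mxE symuv; congr (_ <= _); ring.
Qed.

(** A positive semidefinite form is isotropic only along its kernel: pair [u] with
the basis vectors in the Cauchy-Schwarz inequality. *)
Lemma psd_null k (S : 'M[R]_k) (u : 'rV[R]_k) : psdmx S ->
  (u *m S *m u^T) 0 0 = 0 -> u *m S = 0.
Proof.
move=> psdS uSu; apply/rowP => j; rewrite [RHS]mxE.
have := psd_CauchySchwarz u (delta_mx 0 j) psdS.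
rewrite uSu mul0r trmx_delta -colE mxE => le0.
by apply/eqP; rewrite -sqrf_eq0 eq_le le0 sqr_ge0.
Qed.

Lemma psd_congr k p (S : 'M[R]_k) (N : 'M[R]_(k, p)) :
  psdmx S -> psdmx (N^T *m S *m N).
Proof.
move=> [symS S_ge0]; split=> [|v].
  by rewrite !trmx_mul trmxK symS mulmxA.
by rewrite !mulmxA -mulmxA -{2}(trmxK N) -trmx_mul; exact: S_ge0.
Qed.

Lemma psd_gram k (x : 'rV[R]_k) : psdmx (x^T *m x).
Proof.
split=> [|v]; first by rewrite trmx_mul trmxK.
have -> : v *m (x^T *m x) *m v^T = (v *m x^T) *m (v *m x^T)^T.
  by rewrite trmx_mul trmxK !mulmxA.
by rewrite mxE big_ord1 [X in _ * X]mxE -expr2 sqr_ge0.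
Qed.

(** Cauchy-Schwarz on basis vectors gives [S i j ^+ 2 <= S i i * S j j]; summing
over [i] and [j] gives the square of the trace, without diagonalizing [S]. *)
Lemma psd_frob_le_tr k (S : 'M[R]_k) : psdmx S -> frob S <= \tr S.
Proof.
move=> psdS.
pose e i : 'rV[R]_k := delta_mx 0 i.
have entry i j : S i j = (e i *m S *m (e j)^T) 0 0.
  by rewrite trmx_delta -colE -rowE !mxE.
have diag_ge0 i : 0 <= S i i by rewrite entry; case: psdS => _; apply.
rewrite -[leRHS]ger0_norm ?sumr_ge0// -sqrtr_sqr ler_sqrt ?sqr_ge0//.
rewrite expr2 mulr_suml; apply: ler_sum => i _; rewrite mulr_sumr.
by apply: ler_sum => j _; rewrite !entry; exact: psd_CauchySchwarz.
Qed.

(** A perturbation [K] of the identity changes the pairing with [S] by at most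
[frob K * frob S], and [frob S] is at most the trace. When [frob K < 1] this
makes [1 + K] positive definite in the strong sense needed for uniqueness. *)
Lemma mxdot_psd_ge k (K S : 'M[R]_k) : psdmx S ->
  (1 - frob K) * \tr S <= mxdot (1%:M + K) S.
Proof.
move=> psdS; rewrite mxdotDl {1}/mxdot trmx1 mul1mx.
rewrite mulrBl mul1r lerD2l.
have := mxdot_CauchySchwarz K S; rewrite ler_norml => /andP[+ _].
apply: le_trans; rewrite lerN2.
by apply: ler_wpM2l; [exact: frob_ge0|exact: psd_frob_le_tr].
Qed.

Lemma mxdot_congr k p (H : 'M[R]_p) (N : 'M[R]_(k, p)) (S : 'M[R]_k) :
  mxdot (N *m H *m N^T) S = mxdot H (N^T *m S *m N).
Proof.
by rewrite /mxdot !trmx_mul trmxK -[in LHS]mulmxA mxtrace_mulC !mulmxA.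
Qed.

End PositiveSemidefinite.

(** * Spectrum of a real symmetric matrix *)

Lemma sorted_flatten_nseq (R : realType) (mu : R -> nat) (f : R -> R) (s : seq R) :
  {homo f : x y / x <= y} -> sorted <=%R s ->
  sorted <=%R (flatten [seq nseq (mu x) (f x) | x <- s]).
Proof.
move=> fmon; elim: s => //= x s IHs pxs.
have /IHs ssorted := path_sorted pxs.
have {}pxs : all (fun z => f x <= z) (flatten [seq nseq (mu y) (f y) | y <- s]).
  apply/allP => z /flattenP[_ /mapP[y ys ->]] /nseqP[-> _].
  by apply: fmon; move/allP: (order_path_min le_trans pxs) => /(_ y ys).
elim: (mu x) => //= k IHk; rewrite path_min_sorted//.
by rewrite all_cat pxs all_nseq lexx orbT.
Qed.

Lemma count_flatten_nseq (T U : Type) (mu : U -> nat) (f : U -> T)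
    (a : pred T) (s : seq U) :
  count a (flatten [seq nseq (mu x) (f x) | x <- s]) =
  (\sum_(x <- s) a (f x) * mu x)%N.
Proof.
by elim: s => [|x s IHs]; rewrite ?big_nil//= big_cons count_cat count_nseq IHs.
Qed.

Lemma mup_prod_XsubC (R : realType) (I : Type) (r : seq I) (d : I -> R) x :
  mup x (\prod_(i <- r) ('X - (d i)%:P)) = (\sum_(i <- r) (d i == x))%N.
Proof.
elim: r => [|i r IHr].
  by rewrite !big_nil mupNroot// root1.
rewrite !big_cons mupM ?IHr ?polyXsubC_eq0//; last first.
  by rewrite monic_neq0// monic_prod_XsubC.
by rewrite -[X in mup _ X]expr1 mup_XsubCX; case: eqP.
Qed.

(** In a nonincreasing list the positive entries come first, so with at most
[k.+1] of them each one sits at an index at most [k]. *)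
Lemma nth_le_of_count_gt0 (R : realDomainType) (s : seq R) (k : nat) (x : R) :
  sorted >=%R s -> (count (> 0%R) s <= k.+1)%N -> x \in s -> 0 < x ->
  nth 0 s k <= x.
Proof.
move=> s_sorted cnt xs x_gt0.
have ge_nth i j : (i <= j)%N -> (j < size s)%N -> nth 0 s j <= nth 0 s i.
  move=> ij js.
  apply: (sorted_leq_nth ge_trans ge_refl 0 s_sorted) => //; rewrite inE//.
  exact: leq_ltn_trans ij js.
have js : (index x s < size s)%N by rewrite index_mem.
have [jk|kj] := leqP (index x s) k.
  have [ks|/(nth_default 0)->] := ltnP k (size s); last exact: ltW.
  by rewrite -[leRHS](nth_index 0 xs) ge_nth.
suff : (k.+2 <= count (> 0%R) s)%N by rewrite leqNgt ltnS cnt.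
have ksz : (k.+2 <= size s)%N by exact: leq_ltn_trans kj js.
rewrite -[X in count _ X](cat_take_drop k.+2 s) count_cat.
apply: leq_trans (leq_addr _ _).
have : all (> 0%R) (take k.+2 s).
  apply/(all_nthP 0) => i; rewrite size_takel// => ik; rewrite nth_take//=.
  apply: lt_le_trans x_gt0 _; rewrite -[leLHS](nth_index 0 xs) ge_nth//.
  by rewrite (leq_trans _ kj).
by rewrite all_count => /eqP ->; rewrite size_takel.
Qed.

Lemma mxrank_sum_le (F : fieldType) m n (I : finType) (P : pred I)
    (A : I -> 'M[F]_(m, n)) :
  (\rank (\sum_(i | P i) A i)%R <= \sum_(i | P i) \rank (A i))%N.
Proof.
elim/big_rec2: _ => [|i r B _ IH]; first by rewrite mxrank0.
by apply: leq_trans (mxrank_add _ _) _; rewrite leq_add2l.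
Qed.

(** Adding the indicator of the zero entries makes the diagonal matrix
invertible, and that indicator has rank at most the number of zero entries. *)
Lemma rank_diag_mx_ge (F : fieldType) n (d : 'rV[F]_n) :
  (#|[pred i | d 0 i != 0]%R| <= \rank (diag_mx d))%N.
Proof.
pose e : 'rV[F]_n := \row_i (d 0 i == 0)%:R.
have ranke : (\rank (diag_mx e) <= #|[pred i | d 0 i == 0]%R|)%N.
  rewrite diag_mx_sum_delta -sum1_card [leqRHS]big_mkcond/=.
  apply: leq_trans (mxrank_sum_le _ _) _; apply: leq_sum => i _; rewrite inE mxE.
  by case: eqP => _; rewrite ?scale1r ?mxrank_delta// scale0r mxrank0.
have : (n <= \rank (diag_mx d) + \rank (diag_mx e))%N.
  apply: leq_trans (mxrank_add _ _); rewrite -linearD/= mxrank_unit//.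
  rewrite unitmxE det_diag unitfE; apply/prodf_neq0 => i _.
  by rewrite !mxE; case: (eqVneq (d 0 i) 0) => [->|]; rewrite ?add0r ?oner_eq0 ?addr0.
rewrite -[X in (X <= _)%N](card_ord n) -(cardC [pred i | d 0 i == 0]%R) addnC.
move=> /leq_trans/(_ (leq_add (leqnn _) ranke)).
by rewrite leq_add2r.
Qed.

(** Over an ordered field [v J^T J = 0] forces [|v J^T|^2 = 0], so [J^T J] and [J^T]
have the same left kernel. *)
Lemma rank_gram (R : realFieldType) m n (J : 'M[R]_(m, n)) :
  \rank (J^T *m J) = \rank J.
Proof.
apply/eqP; rewrite eqn_leq mxrankM_maxr/= -[leqLHS]mxrank_tr.
suff : (\rank (kermx (J^T *m J)) <= \rank (kermx J^T))%N.
  by rewrite !mxrank_ker leq_sub2lE ?rank_leq_row.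
apply: mxrankS; apply/rV_subP => v /sub_kermxP; rewrite mulmxA => vJJ.
apply/sub_kermxP.
have /(congr1 (fun A : 'M[R]_1 => A 0 0)) : (v *m J^T) *m (v *m J^T)^T = 0.
  by rewrite trmx_mul trmxK mulmxA vJJ mul0mx.
rewrite !mxE => /eqP; rewrite psumr_eq0 => [/allP h|i _]; last first.
  by rewrite [X in _ * X]mxE -expr2 sqr_ge0.
apply/rowP => i; rewrite [RHS]mxE; apply/eqP.
by have := h i (mem_index_enum i); rewrite [X in _ * X]mxE -expr2 sqrf_eq0.
Qed.

Lemma char_poly_similar (F : comUnitRingType) n (P A : 'M[F]_n) : P \in unitmx ->
  char_poly (invmx P *m A *m P) = char_poly A.
Proof.
move=> Pu; rewrite /char_poly.
pose Q := map_mx polyC P; pose Q' := map_mx polyC (invmx P).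
have Q'Q : Q' *m Q = 1%:M by rewrite -map_mxM mulVmx// map_mx1.
have -> : char_poly_mx (invmx P *m A *m P) = Q' *m char_poly_mx A *m Q.
  rewrite /char_poly_mx mulmxBr mulmxBl !map_mxM; congr (_ - _).
  by rewrite scalar_mxC -mulmxA Q'Q mulmx1.
by rewrite !det_mulmx mulrAC -det_mulmx Q'Q det1 mul1r.
Qed.

Local Open Scope complex_scope.
Local Open Scope sesquilinear_scope.

(** The real content of the complex spectral theorem. The eigenbasis is hidden:
[a i] is the squared modulus of the i-th coordinate of [w] in it, that is, the
weight of the spectral measure of [w] at [d 0 i], and the two identities are the
first and second moments of that measure. *)
Lemma sym_spectrum (R : rcfType) n (B : 'M[R]_n) : B^T = B ->
  exists d : 'rV[R]_n,
  [/\ char_poly B = \prod_i ('X - (d 0 i)%:P),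
      (#|[pred i | d 0 i != 0]%R| <= \rank B)%N
    & forall w : 'rV[R]_n, exists2 a : 'I_n -> R, (forall i, 0 <= a i)
      & (w *m B *m w^T) 0 0 = \sum_i d 0 i * a i
        /\ (w *m B *m (w *m B)^T) 0 0 = \sum_i d 0 i ^+ 2 * a i].
Proof.
move=> symB; pose toC := real_complex R; pose BC : 'M[R[i]]_n := map_mx toC B.
have toC_real m p (A : 'M[R]_(m, p)) : map_mx toC A \is a mxOver Num.real.
  by apply/mxOverP => i j; rewrite mxE; apply/complex_realP; exists (A i j).
have hermBC : BC \is hermsymmx.
  apply: realsym_hermsym; last exact: toC_real.
  by apply/is_hermitianmxP; rewrite expr0 scale1r map_mx_id// map_trmx symB.
have unitP := spectral_unit BC.
have /orthomx_spectralP BCE := hermitian_normalmx hermBC.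
have unitaryP := spectral_unitarymx BC.
have := hermitian_spectral_diag_real hermBC.
move: (spectralmx BC) (spectral_diag BC) BCE unitP unitaryP => P D BCE unitP unitaryP D_real.
pose d : 'rV[R]_n := map_mx (@complex.Re R) D.
have dE i : D 0 i = toC (d 0 i).
  by rewrite mxE [toC _]RRe_real//; move/mxOverP: D_real; apply.
exists d; split.
- apply: (map_poly_inj toC); rewrite map_char_poly -/BC BCE char_poly_similar//.
  rewrite char_poly_trig ?diag_mx_is_trig// rmorph_prod; apply: eq_bigr => i _.
  by rewrite !mxE eqxx mulr1n dE rmorphB/= map_polyX map_polyC.
- rewrite -(mxrank_map toC) -/BC BCE mxrankMfree ?row_free_unit//.
  rewrite eqmxMfull ?row_full_unit ?unitmx_inv//.
  apply: leq_trans (rank_diag_mx_ge _); apply: subset_leq_card.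
  by apply/fintype.subsetP => i; rewrite !inE dE; apply: contra_neq => /complexI.
move=> w; pose wC := map_mx toC w; pose u := wC *m invmx P.
have PwE : P *m wC^T = u^t*.
  rewrite /u invmx_unitary// trmx_mul map_mxM/= trmxCK.
  by rewrite -map_trmx realmxC ?toC_real.
pose nsq (z : R[i]) := complex.Re z ^+ 2 + complex.Im z ^+ 2.
have nsqE (z : R[i]) : z * z^* = toC (nsq z).
  case: z => x y; apply/eqP; rewrite eq_complex/=.
  by rewrite !mulrN opprK -!expr2 eqxx (mulrC y) addNr eqxx.
have moment (v E : 'rV[R[i]]_n) :
    (v *m diag_mx E *m v^t* ) 0 0 = \sum_i E 0 i * toC (nsq (v 0 i)).
  rewrite mul_mx_diag mxE; apply: eq_bigr => i _.
  by rewrite !mxE -nsqE mulrA (mulrC (E 0 i)).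
(* The coordinates of w in the unitary eigenbasis, the rows of P. *)
exists (fun i => nsq (u 0 i)) => [i|]; first by rewrite addr_ge0 ?sqr_ge0.
split; apply: (@complexI R).
  transitivity ((wC *m BC *m wC^T) 0 0).
    by rewrite /wC /BC map_trmx -!map_mxM [RHS]mxE.
  rewrite BCE !mulmxA -/u -mulmxA PwE moment rmorph_sum; apply: eq_bigr => i _.
  by rewrite dE -rmorphM.
transitivity ((wC *m BC *m (BC *m wC^T)) 0 0).
  by rewrite /wC /BC map_trmx -!map_mxM [RHS]mxE trmx_mul symB.
rewrite BCE !mulmxA mulmxK// -/u -!mulmxA PwE (mulmxA (diag_mx D)) mulmx_diag.
rewrite !mulmxA -/u moment rmorph_sum; apply: eq_bigr => i _.
by rewrite mxE dE -!rmorphM expr2.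
Qed.

Local Close Scope complex_scope.
Local Close Scope sesquilinear_scope.

(** * Gradients of quadratic polynomials *)

Section Gradient.
Context {R : realType} {n m : nat}.
Implicit Types (q : quadpoly R n) (g : 'I_m -> quadpoly R n).

Lemma cvg_affine_at0 (a b : R) : (fun h : R => a + h * b) @ 0^' --> a.
Proof.
rewrite -[X in _ --> X]addr0; apply: cvgD; first exact: cvg_cst.
rewrite -[X in _ --> X](mul0r b); apply: cvgMr_tmp.
apply: cvg_within_filter; exact: cvg_id.
Qed.

Lemma qeval_expand q (y v : 'rV[R]_n) (h : R) : (quadA q)^T = quadA q ->
  qeval q (h *: v + y) = qeval q y
    + h * (2 * ((y *m quadA q + quadb q) *m v^T) 0 0)
    + h ^+ 2 * (v *m quadA q *m v^T) 0 0.
Proof.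
move=> symA; rewrite /qeval.
have sym : (v *m quadA q *m y^T) 0 0 = (y *m quadA q *m v^T) 0 0.
  rewrite -[v *m _ *m _]trmxK [LHS]mxE.
  by rewrite !trmx_mul trmxK symA mulmxA.
rewrite linearD linearZ/= !mulmxDl !mulmxDr -!scalemxAl -!scalemxAr.
move: sym; move: (v *m _ *m y^T) (y *m _ *m v^T) (v *m _ *m v^T) (y *m _ *m y^T).
move: (quadb q *m v^T) (quadb q *m y^T).
by move=> a b c d e f sym; rewrite !mxE sym; ring.
Qed.

Lemma differentiable_qeval q (y : 'rV[R]_n) : differentiable (qeval q) y.
Proof.
have coord i : differentiable (fun z : 'rV[R]_n => z 0 i) y.
  exact: differentiable_coord.
rewrite (_ : qeval q =
  \sum_i (\sum_j (quadA q j i *: ((fun z : 'rV[R]_n => z 0 j) * (fun z => z 0 i))))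
  + \sum_i ((2 * quadb q 0 i) *: (fun z : 'rV[R]_n => z 0 i)) + cst (quade q)).
  do 2![apply: differentiableD => //].
    apply: differentiable_sum => i; apply: differentiable_sum => j.
    by apply: differentiableZ; apply: differentiableM.
  by apply: differentiable_sum => i; apply: differentiableZ.
apply/funext => z; rewrite /qeval !fctE !fct_sumE !mxE mulr_sumr.
congr (_ + _ + _).
  apply: eq_bigr => i _; rewrite fct_sumE !mxE mulr_suml; apply: eq_bigr => j _.
  by rewrite !fctE /GRing.scale/= [z 0 j * _]mulrC mulrA.
by apply: eq_bigr => i _; rewrite !mxE fctE /GRing.scale/= mulrA.
Qed.

(** Once differentiability is known, the derivative along [v] can be computed as a
limit of difference quotients, which are affine in the step by
[qeval_expand]. *)
Lemma nablaE g (y : 'rV[R]_n) : (forall i, (quadA (g i))^T = quadA (g i)) ->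
  forall i, row i (nabla g y) = 2 *: (y *m quadA (g i) + quadb (g i)).
Proof.
move=> symg i.
have dF : differentiable (fun z : 'rV[R]_n => \row_i qeval (g i) z : 'rV[R]_m) y.
  rewrite (_ : (fun _ => _) =
    \sum_i (fun z : 'rV[R]_n => qeval (g i) z *: (delta_mx 0 i : 'rV[R]_m))).
    apply: differentiable_sum => j; apply: differentiableZl.
    exact: differentiable_qeval.
  apply/funext => z; rewrite fct_sumE; apply/rowP => k.
  rewrite summxE (bigD1 k)//= !mxE !eqxx mulr1 big1 ?addr0// => j jk.
  by rewrite !mxE eq_sym (negbTE jk) andbF mulr0.
suff grad (v : 'rV[R]_n) :
    (v *m (nabla g y)^T) 0 i = 2 * ((y *m quadA (g i) + quadb (g i)) *m v^T) 0 0.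
  apply/rowP => j; have := grad (delta_mx 0 j).
  by rewrite -rowE trmx_delta -colE !mxE.
rewrite /nabla trmxK -deriveEjacobian//.
rewrite derive_mx; last exact: diff_derivable.
rewrite [LHS]mxE.
apply/cvg_lim => //.
rewrite [(\row_i0 _) 0 i]mxE.
set a := 2 * _; set b := (v *m quadA (g i) *m v^T) 0 0.
apply: cvg_trans (@cvg_affine_at0 a b).
apply: near_eq_cvg; near=> h.
have hN0 : h != 0 by near: h; exact: nbhs_dnbhs_neq.
rewrite /= mxE qeval_expand// -/a -/b.
rewrite [X in _ *: X](_ : _ = h * (a + h * b)); last by ring.
by rewrite /GRing.scale/= mulKf.
Unshelve. all: by end_near.
Qed.
End Gradient.

(** * Norms *)

Lemma frob_row (R : realType) n (v : 'rV[R]_n) : frob v ^+ 2 = (v *m v^T) 0 0.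
Proof.
rewrite sqr_sqrtr ?sumr_ge0// => [|i _]; last by rewrite sumr_ge0// => j _; rewrite sqr_ge0.
by rewrite big_ord1 mxE; apply: eq_bigr => j _; rewrite mxE expr2.
Qed.

Lemma frobZ (R : realType) m n (a : R) (A : 'M[R]_(m, n)) :
  frob (a *: A) = `|a| * frob A.
Proof.
rewrite /frob -sqrtr_sqr -sqrtrM ?sqr_ge0//; congr Num.sqrt.
rewrite mulr_sumr; apply: eq_bigr => i _; rewrite mulr_sumr.
by apply: eq_bigr => j _; rewrite mxE exprMn.
Qed.

Lemma frob0 (R : realType) m n : frob (0 : 'M[R]_(m, n)) = 0.
Proof. by rewrite -(scale0r 0) frobZ normr0 mul0r. Qed.

Lemma frob_coord_le (R : realType) n (v : 'rV[R]_n) i : `|v 0 i| <= frob v.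
Proof.
rewrite -sqrtr_sqr ler_sqrt; last by do 2![apply: sumr_ge0 => ? _]; rewrite sqr_ge0.
rewrite big_ord1 (bigD1 i)//= lerDl; apply: sumr_ge0 => j _; exact: sqr_ge0.
Qed.

(** Homogeneity reduces this to the unit ball. The work is in the boundedness of
the set of norms, as the supremum of an unbounded set is a default value. *)
Lemma frob_le_opnorm (R : realType) n m (G : 'I_m -> 'M[R]_n) (lambda : 'rV[R]_m) :
  frob (\sum_i lambda 0 i *: G i) <= frob lambda * opnorm G.
Proof.
pose L (mu : 'rV[R]_m) := \sum_i mu 0 i *: G i.
have LZ a mu : L (a *: mu) = a *: L mu.
  by rewrite scaler_sumr; apply: eq_bigr => i _; rewrite mxE scalerA.
have ubL : has_ubound [set frob (L mu) | mu in [set mu : 'rV[R]_m | frob mu <= 1]].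
  exists (Num.sqrt (\sum_j \sum_k (\sum_i `|G i j k|) ^+ 2)) => _ [mu mu1 <-].
  rewrite ler_sqrt; last by do 2![apply: sumr_ge0 => ? _]; rewrite sqr_ge0.
  apply: ler_sum => j _; apply: ler_sum => k _.
  rewrite -real_normK ?num_real// ler_pXn2r ?nnegrE ?sumr_ge0// summxE.
  apply: le_trans (ler_norm_sum _ _ _) _; apply: ler_sum => i _.
  rewrite mxE normrM ler_piMl//; exact: le_trans (frob_coord_le mu i) mu1.
have [l0|lN0] := eqVneq (frob lambda) 0.
  rewrite (frob_eq0 l0) big1 => [|i _]; last by rewrite mxE scale0r.
  by rewrite !frob0 mul0r.
have l_gt0 : 0 < frob lambda by rewrite lt_def lN0 frob_ge0.
rewrite -ler_pdivrMl//.
apply: (ub_le_sup ubL); exists ((frob lambda)^-1 *: lambda) => /=.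
  by rewrite frobZ gtr0_norm ?invr_gt0// mulVf.
by rewrite LZ frobZ gtr0_norm ?invr_gt0.
Qed.

(** * Singular values and least-norm multipliers *)

Lemma singular_value_ge0 (R : realType) m n (J : 'M[R]_(m, n)) (k : nat) :
  0 <= nth 0 (singular_values J) k.
Proof.
have /(all_nthP 0) h : all (>= 0) (singular_values J).
  rewrite all_rev; apply/allP => x /flattenP[_ /mapP[y _ ->]] /nseqP[-> _].
  exact: sqrtr_ge0.
by case: (ltnP k (size (singular_values J))) => [/h|/(nth_default 0)->].
Qed.

(** At most [k.+1] eigenvalues of [J^T J] are nonzero, so the square root of any
positive one is among the [k.+1] largest singular values. *)
Lemma singular_value_le_sqrt_eigenvalue (R : realType) m n (J : 'M[R]_(m, n))
    (d : 'rV[R]_n) (k : nat) (i : 'I_n) :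
  char_poly (J^T *m J) = \prod_j ('X - (d 0 j)%:P) ->
  (#|[pred j | d 0 j != 0]%R| <= k.+1)%N -> 0 < d 0 i ->
  nth 0 (singular_values J) k <= Num.sqrt (d 0 i).
Proof.
move=> charE pos_le di_gt0; rewrite /singular_values charE.
set p := \prod_j _.
have pN0 : p != 0 by rewrite monic_neq0// monic_prod_XsubC.
have mupE x : mup x p = (\sum_j (d 0%R j == x))%N by exact: mup_prod_XsubC.
have mup_gt0 : (0 < mup (d 0%R i) p)%N by rewrite mupE (bigD1 i)//= eqxx.
apply: nth_le_of_count_gt0.
- rewrite rev_sorted; apply: sorted_flatten_nseq; first exact: ler_wsqrtr.
  by apply: sub_sorted (sorted_roots _ _ _) => x y; exact: ltW.
- rewrite count_rev count_flatten_nseq; apply: leq_trans pos_le.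
  (* Count pairs of a root and an index with that eigenvalue, by index. *)
  under eq_bigr do rewrite mupE big_distrr/=.
  rewrite exchange_big/= -sum1_card [leqRHS]big_mkcond/=.
  apply: leq_sum => j _; rewrite inE.
  have [dj0|djN0] := eqVneq (d 0 j) 0.
    rewrite big1// => x _; case: eqP => [<-|]; rewrite ?muln0//.
    by rewrite dj0 sqrtr0 ltxx.
  apply: (@leq_trans (count_mem (d 0 j) (rootsR p))).
    rewrite -sum1_count [leqRHS]big_mkcond; apply: leq_sum => x _ /=.
    by rewrite eq_sym; case: (_ < _); case: (_ == _).
  by rewrite count_uniq_mem ?leq_b1// uniq_roots.
- rewrite mem_rev; apply/flattenP.
  exists (nseq (mup (d 0 i) p) (Num.sqrt (d 0 i))); last first.
    by apply/nseqP.
  apply: (map_f (fun x => nseq (mup x p) (Num.sqrt x))).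
  have := roots_on_rootsR pN0 (d 0 i).
  by rewrite in_itv/= => <-; rewrite -dvdp_XsubCl XsubC_dvd.
- by rewrite sqrtr_gt0.
Qed.

(** Solving [w J^T J = delta] and taking [lambda = w J^T] gives the solution of
least norm. In the spectral measure of [w], [frob lambda ^+ 2] is the first moment
and [frob delta ^+ 2] the second, so the bound reduces to
[sigma ^+ 2 * d <= d ^+ 2] at each eigenvalue [d]: clear if [d <= 0], and otherwise
[sigma <= sqrt d]. *)
Lemma multiplier_norm_bound (R : realType) m n (J : 'M[R]_(m, n)) (delta : 'rV[R]_n) k :
  \rank J = k.+1 -> (delta <= J)%MS ->
  exists2 lambda : 'rV[R]_m, lambda *m J = delta
    & nth 0 (singular_values J) k * frob lambda <= frob delta.
Proof.
have := singular_value_ge0 J k; set sigma := nth _ _ _ => sigma_ge0 rankJ deltaJ.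
have symB : (J^T *m J)^T = J^T *m J by rewrite trmx_mul trmxK.
have [d [charE rank_ge moments]] := sym_spectrum symB.
have /submxP[w wE] : (delta <= J^T *m J)%MS.
  have /geq_leqif := mxrank_leqif_sup (submxMl J^T J).
  by rewrite rank_gram leqnn => /esym/(submx_trans deltaJ).
exists (w *m J^T); first by rewrite -mulmxA -wE.
have [a a_ge0 [m1 m2]] := moments w.
rewrite -(@ler_pXn2r _ 2)// ?nnegrE ?mulr_ge0 ?frob_ge0 ?sigma_ge0//.
rewrite exprMn !frob_row trmx_mul trmxK mulmxA -(mulmxA w) m1 wE m2 mulr_sumr.
apply: ler_sum => i _; rewrite mulrA ler_wpM2r// [d 0 i ^+ 2]expr2.
have [di_gt0|di_le0] := ltP 0 (d 0 i); last first.
  by rewrite (@le_trans _ _ 0)// ?sqr_ge0// mulr_ge0_le0// sqr_ge0.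
rewrite ler_pM2r//.
rewrite -(sqr_sqrtr (ltW di_gt0)) ler_pXn2r ?nnegrE ?sigma_ge0 ?sqrtr_ge0//.
apply: singular_value_le_sqrt_eigenvalue => //.
by rewrite -rankJ -rank_gram.
Qed.

(** * The homogenized problem and its relaxations *)

Section Relaxation.
Context {R : realType} {n m : nat}.
Implicit Types (q f : quadpoly R n) (g : 'I_m -> quadpoly R n) (y : 'rV[R]_n).

Lemma lift1_block y : lift1 y = block_mx 1%:M y y^T (y^T *m y).
Proof. by rewrite /lift1 tr_row_mx mul_col_row trmx1 !mul1mx mulmx1. Qed.

Lemma E00_block : E00 R n = block_mx 1%:M 0 0 0.
Proof.
by rewrite -[LHS]submxK; congr block_mx; apply/matrixP => i j;
  rewrite !mxE -!val_eqE/= ?ord1 ?andbF.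
Qed.

Lemma mxdot_lift1 q y : mxdot (hommx q) (lift1 y) = qeval q y.
Proof.
rewrite mxdot_gram /hommx /qeval.
rewrite mul_row_block tr_row_mx mul_row_col !mul1mx trmx1 mulmx1 mulmxDl.
have -> : y *m (quadb q)^T = quadb q *m y^T.
  by apply/matrixP => i j; rewrite !ord1 -{1}[y]trmxK -trmx_mul mxE.
move: (y *m _ *m _) (quadb q *m y^T) => a b; rewrite !mxE mulr1n; ring.
Qed.

Lemma mxdot_E00 (S : 'M[R]_(1 + n)) : mxdot (E00 R n) S = ulsubmx S 0 0.
Proof.
rewrite mxdotE (bigD1 ord0)//= (bigD1 ord0)//= !big1 => [|i iN0|i iN0].
- rewrite mxE eqxx mul1r !addr0 !mxE; congr (S _ _); exact/val_inj.
- by rewrite big1// => j _; rewrite mxE (negbTE iN0) mul0r.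
- by rewrite mxE (negbTE iN0) andbF mul0r.
Qed.

Lemma lift1_inj : injective (@lift1 R n).
Proof. by move=> y z; rewrite !lift1_block => /eq_block_mx[]. Qed.

Lemma lift1_feasible g y : variety g y -> primal_feasible g (lift1 y).
Proof.
move=> gy; split=> [i||]; rewrite ?mxdot_lift1//; last exact: psd_gram.
by rewrite mxdot_E00 lift1_block block_mxKul mxE.
Qed.

(** The matrix, acting on row vectors from the right, of
[(z0, u) |-> u - z0 y]; its kernel is the line of [(1, y)]. *)
Definition centering y : 'M[R]_(1 + n, n) := col_mx (- y) 1%:M.

(** By [psd_null] the hypothesis strengthens to [(centering y)^T *m S = 0], that is,
every column of [S] is a multiple of [(1, y)]. Symmetry and the top left entry
determine the multiples. *)
Lemma centering_lift1 y (S : 'M[R]_(1 + n)) : psdmx S -> mxdot (E00 R n) S = 1 ->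
  (centering y)^T *m S *m centering y = 0 -> S = lift1 y.
Proof.
move=> psdS; rewrite mxdot_E00 => S00 NSN.
have ulE : ulsubmx S = 1%:M by apply/matrixP => i j; rewrite !ord1 S00 mxE.
have NS : (centering y)^T *m S = 0.
  apply/row_matrixP => j; rewrite row_mul row0; apply: psd_null => //.
  by rewrite tr_row trmxK -row_mul colE mulmxA -colE -row_mul NSN !mxE.
have symS : (dlsubmx S)^T = ursubmx S by rewrite trmx_dlsub psdS.1.
move: NS; rewrite /centering tr_col_mx trmx1 -{1}(submxK S) mul_row_block.
rewrite -[0]hsubmxK => /eq_row_mx[].
rewrite !linear0 !mul1mx ulE mulmx1 linearN/= => /eqP; rewrite addrC subr_eq0 => /eqP dlE.
move: symS; rewrite dlE trmxK => urE.
rewrite -urE mulNmx => /eqP; rewrite addrC subr_eq0 => /eqP drE.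
by rewrite lift1_block -[LHS]submxK ulE dlE drE -urE.
Qed.

(** A quadratic that is stationary at [y] with value 0 there is
[u |-> (u - y) A (u - y)^T], and homogenizing replaces [u - y] by [u - z0 y]. *)
Lemma hommx_centered q y : (quadA q)^T = quadA q -> quadb q = - (y *m quadA q) ->
  qeval q y = 0 -> hommx q = centering y *m quadA q *m (centering y)^T.
Proof.
move=> symA bE qy0.
have eE : (quade q)%:M = y *m quadA q *m y^T.
  apply/matrixP => i j; rewrite !ord1 mxE mulr1n; move: qy0.
  by rewrite /qeval bE mulNmx; move: (y *m _ *m _) => a; rewrite mxE; lra.
rewrite /centering mul_col_mx tr_col_mx mul_col_row trmx1 !mulmx1 mul1mx.
rewrite mulNmx linearN/= !mulmxN mulNmx opprK -eE -bE.
by rewrite /hommx bE linearN/= trmx_mul symA.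
Qed.

(** The dual variable [p.1] of the constraint [z0 ^+ 2 = 1] shifts the constant
term, so that the dual slack matrix is the homogenization of an ordinary
quadratic. *)
Definition lagrangian f g (p : R * 'rV[R]_m) : quadpoly R n :=
  QuadPoly (quadA f + \sum_i p.2 0 i *: quadA (g i))
           (quadb f + \sum_i p.2 0 i *: quadb (g i))
           (quade f + p.1 + \sum_i p.2 0 i * quade (g i)).

Lemma sum_block_mx (F : nmodType) (I : finType) m1 m2 n1 n2
    (A : I -> 'M[F]_(m1, n1)) (B : I -> 'M[F]_(m1, n2))
    (C : I -> 'M[F]_(m2, n1)) (D : I -> 'M[F]_(m2, n2)) :
  \sum_i block_mx (A i) (B i) (C i) (D i) =
  block_mx (\sum_i A i) (\sum_i B i) (\sum_i C i) (\sum_i D i).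
Proof.
elim: (index_enum I) => [|i r IHr]; first by rewrite !big_nil block_mx_const.
by rewrite !big_cons IHr add_block_mx.
Qed.

Lemma hommx_lagrangian f g p : hommx (lagrangian f g p) =
  hommx f + p.1 *: E00 R n + \sum_i p.2 0 i *: hommx (g i).
Proof.
rewrite E00_block /hommx (eq_bigr _ (fun i _ => scale_block_mx _ _ _ _ _)).
rewrite sum_block_mx scale_block_mx !add_block_mx !scaler0 !addr0.
congr block_mx; last first.
  rewrite linearD linear_sum/=; congr (_ + _).
  by apply: eq_bigr => i _; rewrite linearZ.
rewrite !raddfD raddf_sum/= scale_scalar_mx mulr1; congr (_ + _).
by apply: eq_bigr => i _; rewrite scale_scalar_mx.
Qed.

Lemma mxdot_lagrangian f g p (S : 'M[R]_(1 + n)) : primal_feasible g S ->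
  mxdot (hommx (lagrangian f g p)) S = primal_objective f S + p.1.
Proof.
move=> [gS S1 _]; rewrite hommx_lagrangian !mxdotDl mxdotZl S1 mulr1 mxdot_suml.
by rewrite big1 ?addr0// => i _; rewrite mxdotZl gS mulr0.
Qed.

Lemma opt_min_attained T (h : T -> R) (D : set T) x : D x ->
  (forall z, D z -> h x <= h z) -> opt_min h D = (h x)%:E.
Proof.
move=> Dx hx; apply/eqP; rewrite eq_le; apply/andP; split.
  by apply: ereal_inf_lbound; exists x.
by apply: le_ereal_inf_tmp => _ [z Dz <-]; rewrite lee_fin hx.
Qed.

Lemma opt_max_attained T (h : T -> R) (D : set T) x : D x ->
  (forall z, D z -> h z <= h x) -> opt_max h D = (h x)%:E.
Proof.
move=> Dx hx; apply/eqP; rewrite eq_le; apply/andP; split.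
  by apply: ge_ereal_sup => _ [z Dz <-]; rewrite lee_fin hx.
by apply: ereal_sup_ubound; exists x.
Qed.

(** If the slack matrix pairs nonnegatively with every positive semidefinite matrix,
complementary slackness bounds the primal objective below by [qeval f y], and the
bound is attained only where the pairing vanishes. The original problem embeds
in the primal by [lift1], so its minimizers are governed by the same
inequality. *)
Lemma tight_of_certificate f g y p : variety g y ->
  (hommx (lagrangian f g p))^T = hommx (lagrangian f g p) -> dual_objective p = qeval f y ->
  (forall S, primal_feasible g S -> mxdot (hommx (lagrangian f g p)) S = 0 ->
     S = lift1 y) ->
  (forall S, psdmx S -> 0 <= mxdot (hommx (lagrangian f g p)) S) ->
  zero_duality_gap f g /\ sdp_recovers_minimizer f g.
Proof.
move=> gy symL pE uniq L_ge0.
have fy : primal_objective f (lift1 y) = qeval f y by exact: mxdot_lift1.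
have lb S : primal_feasible g S -> qeval f y <= primal_objective f S.
  move=> PS; have [_ _ psdS] := PS.
  have := L_ge0 S psdS; rewrite mxdot_lagrangian// -pE /dual_objective; lra.
have eqS S : primal_feasible g S -> primal_objective f S <= qeval f y -> S = lift1 y.
  move=> PS Sy; apply: uniq => //; rewrite mxdot_lagrangian//.
  have := lb S PS; move: pE; rewrite /dual_objective; lra.
have minE : opt_min (qeval f) (variety g) = (qeval f y)%:E.
  apply: opt_min_attained => // z gz.
  by rewrite -(mxdot_lift1 f z); apply/lb/lift1_feasible.
split; [split|exists y; split].
- rewrite minE -fy; apply/esym/opt_min_attained; first exact: lift1_feasible.
  by move=> S PS; rewrite fy lb.
- rewrite minE -pE; apply/esym/opt_max_attained.
    rewrite /dual_feasible/= -hommx_lagrangian; split=> // v.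
    by rewrite -mxdot_gram L_ge0//; exact: psd_gram.
  move=> p' [_ /(_ (row_mx 1%:M y))]; rewrite -hommx_lagrangian -mxdot_gram.
  by rewrite mxdot_lagrangian ?fy -?pE /dual_objective; [lra|exact: lift1_feasible].
- apply/seteqP; split=> [z [gz zmin]|z ->].
    apply: lift1_inj; apply: eqS; first exact: lift1_feasible.
    by rewrite /primal_objective mxdot_lift1 zmin.
  by split=> // z' gz'; rewrite -(mxdot_lift1 f z'); apply/lb/lift1_feasible.
- apply/seteqP; split=> [S [PS Smin]|S ->].
    by apply: eqS => //; rewrite -fy Smin//; exact: lift1_feasible.
  by split=> [|T PT]; [exact: lift1_feasible|rewrite fy lb].
Qed.

End Relaxation.

(** * Exactness near a regular point *)

(** Stationarity is the hypothesis on [lambda *m nabla g y], and smallness of the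
perturbation makes the Hessian of the Lagrangian positive definite. *)
Lemma tight_of_multiplier (R : realType) n m (g : 'I_m -> quadpoly R n)
    (y theta : 'rV[R]_n) (lambda : 'rV[R]_m) :
  (forall i, (quadA (g i))^T = quadA (g i)) -> variety g y ->
  lambda *m nabla g y = 2 *: (theta - y) ->
  frob (\sum_i lambda 0 i *: quadA (g i)) < 1 ->
  zero_duality_gap (sqdist theta) g /\ sdp_recovers_minimizer (sqdist theta) g.
Proof.
move=> symg gy stat; set K := \sum_i _ => K_lt1.
pose p := (- qeval (sqdist theta) y, lambda); pose L := lagrangian (sqdist theta) g p.
have symA : (quadA L)^T = quadA L.
  rewrite linearD/= trmx1 linear_sum/=; congr (_ + _).
  by apply: eq_bigr => i _; rewrite linearZ/= symg.
have LE : hommx L = centering y *m (1%:M + K) *m (centering y)^T.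
  apply: (@hommx_centered _ _ L y) => //=.
  - have {}stat : y *m K + \sum_i lambda 0 i *: quadb (g i) = theta - y.
      apply: (@scalerI _ _ (2 : R)); first by rewrite pnatr_eq0.
      rewrite -stat /K mulmx_sumr [RHS]mulmx_sum_row -big_split/= scaler_sumr.
      apply: eq_bigr => i _; rewrite nablaE// -scalemxAr -scalerDr.
      by rewrite !scalerA mulrC.
    rewrite -[\sum_i _](addKr (y *m K)) stat addrCA addKr.
    by rewrite mulmxDr mulmx1 opprD addrC.
  - rewrite -mxdot_lift1 mxdot_lagrangian; last exact: lift1_feasible.
    by rewrite /primal_objective mxdot_lift1 subrr.
have ge0 S : psdmx S ->
    (1 - frob K) * \tr ((centering y)^T *m S *m centering y) <= mxdot (hommx L) S.
  by move=> psdS; rewrite LE mxdot_congr; exact/mxdot_psd_ge/psd_congr.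
have tr_ge0 S : psdmx S -> 0 <= \tr ((centering y)^T *m S *m centering y).
  by move=> psdS; apply: le_trans (psd_frob_le_tr (psd_congr _ psdS)); exact: frob_ge0.
have L_ge0 S : psdmx S -> 0 <= mxdot (hommx L) S.
  move=> psdS; apply: le_trans (ge0 S psdS).
  by rewrite mulr_ge0 ?tr_ge0// subr_ge0 ltW.
apply: (@tight_of_certificate _ _ _ (sqdist theta) g y p) => //.
- by rewrite LE !trmx_mul trmxK -[1%:M + K]/(quadA L) symA mulmxA.
- by rewrite /dual_objective opprK.
- move=> S [_ S1 psdS] LS0; apply: centering_lift1 => //.
  apply: frob_eq0; apply/eqP; rewrite eq_le frob_ge0 andbT.
  apply: le_trans (psd_frob_le_tr (psd_congr _ psdS)) _.
  rewrite -(@pmulr_rle0 _ (1 - frob K)) ?subr_gt0//.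
  by rewrite (le_trans (ge0 S psdS))// LS0.
Qed.

(* The quotient is taken in the extended reals, where x / 0 = +oo for x > 0:
   if the constraints are all affine, the bound on theta is vacuous. *)
Theorem corollary3p13 (R : realType) (n m : nat)
    (G : 'I_m -> 'M[R]_n) (l : 'I_m -> 'rV[R]_n) (c : 'I_m -> R)
    (g : 'I_m -> quadpoly R n) (thetabar theta : 'rV[R]_n) (s : nat) :
  (forall i, (G i)^T = G i) ->
  (forall i, g i = quadpoly_of (G i) (l i) (c i)) ->
  variety g thetabar ->
  ACQ g thetabar s ->
  (theta - thetabar <= nabla g thetabar)%MS ->
  ((frob (theta - thetabar))%:E
     < singular_value (nabla g thetabar) s / (2 * opnorm G)%:E)%E ->
  zero_duality_gap (sqdist theta) g /\ sdp_recovers_minimizer (sqdist theta) g.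
Proof.
move=> symG gE gtheta [_ rankJ] normal close.
have quadAE i : quadA (g i) = G i by rewrite gE.
have symg i : (quadA (g i))^T = quadA (g i) by rewrite quadAE.
suff [lambda stat lambda_small] : exists2 lambda : 'rV[R]_m,
    lambda *m nabla g thetabar = 2 *: (theta - thetabar) & frob lambda * opnorm G < 1.
  apply: (tight_of_multiplier symg gtheta stat).
  under eq_bigr do rewrite quadAE.
  exact: le_lt_trans (frob_le_opnorm G lambda) lambda_small.
(* For s = 0 the gradients vanish, so theta = thetabar. *)
case: s rankJ close => [/eqP|k rankJ].
  rewrite mxrank_eq0 => /eqP J0 _; exists 0; last by rewrite frob0 mul0r ltr01.
  by move: normal; rewrite J0 mulmx0 => /submx0null ->; rewrite scaler0.
have [lambda stat lambda_le] := multiplier_norm_bound rankJ (scalemx_sub 2 normal).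
move=> close; exists lambda => //.
(* A vanishing operator norm makes the quotient infinite, but also K = 0. *)
have [op_le0|op_gt0] := leP (opnorm G) 0.
  by rewrite (le_lt_trans _ ltr01)// mulr_ge0_le0// frob_ge0.
move: close lambda_le; rewrite /= inver gt_eqF ?mulr_gt0// -EFinM lte_fin.
rewrite ltr_pdivlMr ?mulr_gt0// frobZ gtr0_norm//.
set sigma := nth _ _ _; set delta := frob (_ - _) => close lambda_le.
have sigma_gt0 : 0 < sigma.
  by apply: le_lt_trans close; rewrite !mulr_ge0 ?frob_ge0// ltW.
rewrite -(ltr_pM2l sigma_gt0) mulr1 mulrA.
apply: le_lt_trans close; rewrite mulrA ler_pM2r//.
by rewrite [delta * 2]mulrC.
Qed.
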